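(* For $K\in\mathbb R^{m\times p}$, $h\in\mathbb R^p$, $\alpha\in(0,1)$ and $y\in\mathbb R^m$ define the Rust–Burrus interval $$I_{\mathrm{RB}}(y)=\Big[\min_{x\ge0,\ \|y-Kx\|_2^2\le\psi_\alpha^2(y)}h^\top x,\ \max_{x\ge0,\ \|y-Kx\|_2^2\le\psi_\alpha^2(y)}h^\top x\Big],\qquad \psi^2_\alpha(y)=z_{\alpha/2}^2+s^2(y),\quad s^2(y)=\min_{x\ge0}\|y-Kx\|_2^2,$$ where $z_{\alpha/2}$ satisfies $\mathbb P(N>z_{\alpha/2})=\alpha/2$ for $N\sim\mathcal N(0,1)$. Consider the model $y\sim\mathcal N(Kx^*,I_m)$ with $x^*\ge0$. (a) For $K=I_2$, $h=(1,-1)^\top$ and $x^*=(a,a)^\top$ with any $a\ge0$, one has $\mathbb P(h^\top x^*\in I_{\mathrm{RB}}(y))\ge1-\alpha$ for every $\alpha\in(0,1)$; so this is not a counterexample to the conjecture that $I_{\mathrm{RB}}$ always has coverage at least $1-\alpha$. (b) For $K=I_3$, $h=(1,1,-1)^\top$ and $x^*=(0,0,1)^\top$, there exists $\alpha\in(0,1)$ with $\mathbb P(h^\top x^*\in I_{\mathrm{RB}}(y))<1-\alpha$. Hence the Rust–Burrus conjecture (that $I_{\mathrm{RB}}(y)$ is a valid $1-\alpha$ confidence interval for $h^\top x^*$ for all $K,h,x^*\ge0,\alpha$) is false.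
   Context: Inequalities $x\ge0$ between vectors are componentwise. *)

(* Defs.v *)
From HB Require Import structures.
From mathcomp Require Import all_boot all_order all_algebra.
From mathcomp Require Import all_classical all_reals all_analysis.
Set Implicit Arguments. Unset Strict Implicit. Unset Printing Implicit Defensive.
Import Order.TTheory GRing.Theory Num.Theory.
Local Open Scope classical_set_scope.
Local Open Scope ring_scope.

Section RustBurrus.
Context {R : realType} {m p : nat}.

Definition nonneg_vec (x : 'cV[R]_p) : Prop := forall i, 0 <= x i 0.

Definition sqnorm2 {n : nat} (v : 'cV[R]_n) : R := \sum_(i < n) (v i 0) ^+ 2.

Definition dotv {n : nat} (h x : 'cV[R]_n) : R := \sum_(i < n) h i 0 * x i 0.

Definition rb_s2 (K : 'M[R]_(m, p)) (y : 'cV[R]_m) : R :=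
  inf [set sqnorm2 (y - K *m x) | x in nonneg_vec].

Definition rb_psi2 (z : R) (K : 'M[R]_(m, p)) (y : 'cV[R]_m) : R :=
  z ^+ 2 + rb_s2 K y.

Definition rb_feasible (z : R) (K : 'M[R]_(m, p)) (y : 'cV[R]_m) : set 'cV[R]_p :=
  [set x | nonneg_vec x /\ sqnorm2 (y - K *m x) <= rb_psi2 z K y].

Definition rb_lower (z : R) (K : 'M[R]_(m, p)) (h : 'cV[R]_p) (y : 'cV[R]_m) : \bar R :=
  ereal_inf [set (dotv h x)%:E | x in rb_feasible z K y].
Definition rb_upper (z : R) (K : 'M[R]_(m, p)) (h : 'cV[R]_p) (y : 'cV[R]_m) : \bar R :=
  ereal_sup [set (dotv h x)%:E | x in rb_feasible z K y].

Definition in_IRB (z : R) (K : 'M[R]_(m, p)) (h : 'cV[R]_p) (y : 'cV[R]_m) (t : R) : Prop :=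
  (rb_lower z K h y <= t%:E)%E /\ (t%:E <= rb_upper z K h y)%E.

End RustBurrus.

Definition is_upper_quantile {R : realType} (alpha z : R) : Prop :=
  normal_prob 0 1 `]z, +oo[%classic = (alpha / 2)%:E.

Definition vec2 {R : realType} (y : R * R) : 'cV[R]_2 :=
  \col_(i < 2) [:: y.1; y.2]`_i.
Definition vec3 {R : realType} (y : (R * R) * R) : 'cV[R]_3 :=
  \col_(i < 3) [:: y.1.1; y.1.2; y.2]`_i.

Definition gauss2 {R : realType} (mu : 'cV[R]_2) : set (R * R) -> \bar R :=
  product_measure1 (normal_prob (mu 0 0) 1) (normal_prob (mu 1 0) 1).
Definition gauss3 {R : realType} (mu : 'cV[R]_3) : set ((R * R) * R) -> \bar R :=
  product_measure1
    (product_measure1 (normal_prob (mu 0 0) 1) (normal_prob (mu 1 0) 1))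
    (normal_prob (mu 2 0) 1).

(* Main.v *)
(* For K = I_n the residual s^2(y) is the squared distance from y to the
   nonnegative orthant.
   (a) If (y1 - y2)^2 <= 2 z^2 then the diagonal point nearest to y (or 0) is
   feasible, so the interval covers with probability at least
   P(|y1 - y2| <= sqrt 2 z) = P(|N| <= z) = 1 - alpha.
   (b) Let z tend to 0 and write y = (u, v, 1 + w).  Up to events of probability
   O(z^2), coverage forces |w - u^+ - v^+| <= sqrt k z, where k - 1 is the number
   of positive coordinates among u, v.  Relative to P(|N| <= z), this has
   probability 1/4 on each of the three quadrants of (u, v) other than u, v > 0;
   on u, v > 0 the inequality (u + v)^2 >= u^2 + v^2 bounds it by
   sqrt 3 / 8 < 1/4.  The ratios sum to less than 1, and z = 10^-5 is small
   enough. *)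
Require Import Defs.
From HB Require Import structures.
From mathcomp Require Import all_boot all_order all_algebra.
From mathcomp Require Import all_classical all_reals all_analysis.
From mathcomp Require Import measurable_realfun ring lra.
Import Order.TTheory GRing.Theory Num.Theory.
Import numFieldNormedType.Exports.
Local Open Scope classical_set_scope.
Local Open Scope ring_scope.

(** * The Rust-Burrus interval for the identity matrix *)

Lemma in_IRB_feasible (R : realType) (m p : nat) (z : R) (K : 'M[R]_(m, p))
    (h : 'cV[R]_p) (y : 'cV[R]_m) (x : 'cV[R]_p) :
  rb_feasible z K y x -> in_IRB z K h y (dotv h x).
Proof.
move=> fx; split.
- by apply: ereal_inf_lbound; exists x.
- by apply: ereal_sup_ubound; exists x.
Qed.

(** The endpoints are an infimum and a supremum whose attainment is not established; the slack [e]
    replaces extremal points by nearly extremal ones. *)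
Lemma in_IRB_approx (R : realType) (m p : nat) (z : R) (K : 'M[R]_(m, p))
    (h : 'cV[R]_p) (y : 'cV[R]_m) (t e : R) : 0 < e -> in_IRB z K h y t ->
  (exists2 x, rb_feasible z K y x & dotv h x < t + e) /\
  (exists2 x, rb_feasible z K y x & t - e < dotv h x).
Proof.
move=> e0 [lo up]; split.
- have : (rb_lower z K h y < (t + e)%:E)%E.
    by apply: le_lt_trans lo _; rewrite lte_fin ltrDl.
  by move=> /ereal_inf_lt [_ [x fx <-]]; rewrite lte_fin => ?; exists x.
- have : ((t - e)%:E < rb_upper z K h y)%E.
    by apply: lt_le_trans up; rewrite lte_fin ltrBlDr ltrDl.
  by move=> /ereal_sup_gt [_ [x fx <-]]; rewrite lte_fin => ?; exists x.
Qed.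

(** The infimum is attained at the positive part [y'] of [y], which leaves the negative part as
    residual. *)
Lemma rb_s2_id (R : realType) (n : nat) (y : 'cV[R]_n) :
  rb_s2 1%:M y = \sum_(i < n) Num.min (y i 0) 0 ^+ 2.
Proof.
pose f (x : 'cV[R]_n) := sqnorm2 (y - 1%:M *m x).
pose y' : 'cV[R]_n := \col_i Num.max (y i 0) 0.
have lb x : nonneg_vec x -> \sum_(i < n) Num.min (y i 0) 0 ^+ 2 <= f x.
  move=> x0; apply: ler_sum => i _; rewrite mul1mx !mxE.
  have := x0 i; move: (x i 0) (y i 0) => a b a0.
  case: (leP b 0) => b0; last by rewrite expr0n sqr_ge0.
  rewrite sqrrB; have := mulr_ge0_le0 a0 b0; have := sqr_ge0 a.
  by rewrite mulr2n; lra.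
have y'0 : nonneg_vec y' by move=> i; rewrite mxE le_max lexx orbT.
have fy' : f y' = \sum_(i < n) Num.min (y i 0) 0 ^+ 2.
  apply: eq_bigr => i _; rewrite mul1mx !mxE.
  by case: (leP (y i 0) 0) => yi; rewrite ?subr0 ?subrr.
apply/eqP; rewrite eq_le; apply/andP; split.
- rewrite -fy'; apply: ge_inf; last by exists y'.
  by exists 0 => _ [x _ <-]; apply: sumr_ge0 => i _; exact: sqr_ge0.
- apply: lb_le_inf; first by exists (f y'); exists y'.
  by move=> _ [x x0 <-]; exact: lb.
Qed.

Lemma rb_feasible_id (R : realType) (n : nat) (z : R) (y x : 'cV[R]_n) :
  rb_feasible z 1%:M y x <->
  (forall i, 0 <= x i 0) /\
  \sum_(i < n) (y i 0 - x i 0) ^+ 2 <=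
    z ^+ 2 + \sum_(i < n) Num.min (y i 0) 0 ^+ 2.
Proof.
rewrite /rb_feasible /rb_psi2 rb_s2_id /= /sqnorm2 mul1mx.
have -> // : \sum_(i < n) (y - x) i 0 ^+ 2 = \sum_(i < n) (y i 0 - x i 0) ^+ 2.
by apply: eq_bigr => i _; rewrite !mxE.
Qed.

(** The witness [(b, b)] is the point of the diagonal ray nearest to [y], and [h] vanishes on the
    diagonal. *)
Lemma strip_in_IRB (R : realType) (z : R) (y : R * R) (h : 'cV[R]_2) :
  h 0 0 = 1 -> h 1 0 = - 1 -> (y.1 - y.2) ^+ 2 <= 2 * z ^+ 2 ->
  in_IRB z 1%:M h (vec2 y) 0.
Proof.
case: y => u v /= h0 h1 uv.
pose b : R := Num.max ((u + v) / 2) 0.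
have -> : 0 = dotv h (\col_(i < 2) b).
  rewrite /dotv !big_ord_recl big_ord0 /= !mxE h0.
  by rewrite (_ : lift ord0 ord0 = 1) ?h1; [ring|apply/val_inj].
apply: in_IRB_feasible; apply/rb_feasible_id; split.
  by move=> i; rewrite mxE le_max lexx orbT.
rewrite !big_ord_recl !big_ord0 !mxE /= /b.
by case: (leP ((u + v) / 2) 0); case: (leP u 0); case: (leP v 0); nra.
Qed.

(** Cauchy-Schwarz, with [sqrt 2] rounded up to [283/200]. *)
Lemma sqr_sum2_le (R : realType) (a b z : R) : 0 <= z ->
  a ^+ 2 + b ^+ 2 <= z ^+ 2 -> `|a + b| <= 283 / 200 * z.
Proof.
move=> z0 ab; rewrite -(@ler_pXn2r _ 2)// ?nnegrE ?mulr_ge0//.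
rewrite real_normK ?num_real//; have := sqr_ge0 (a - b).
have := sqr_ge0 z; rewrite !expr2 in ab *; lra.
Qed.

(** Cauchy-Schwarz, with [sqrt 3] rounded up to [87/50]. *)
Lemma sqr_sum3_le (R : realType) (a b c z : R) : 0 <= z ->
  a ^+ 2 + b ^+ 2 + c ^+ 2 <= z ^+ 2 -> `|a + b + c| <= 87 / 50 * z.
Proof.
move=> z0 abc; rewrite -(@ler_pXn2r _ 2)// ?nnegrE ?mulr_ge0//.
rewrite real_normK ?num_real//; have := sqr_ge0 (a - b).
have := sqr_ge0 (a - c); have := sqr_ge0 (b - c).
have := sqr_ge0 z; rewrite !expr2 in abc *; lra.
Qed.

(** For [u <= 0] the two sides differ by the cross term [- 2 u x >= 0]. *)
Lemma sqr_sub_max (R : realType) (u x : R) : 0 <= x ->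
  (Num.max u 0 - x) ^+ 2 <= (u - x) ^+ 2 - Num.min u 0 ^+ 2.
Proof.
move=> x0; case: (leP u 0) => u0; last by rewrite expr0n subr0.
by have := mulr_le0_ge0 u0 x0; rewrite !expr2; lra.
Qed.

(** The difference of squares is [x^2 - 2 u x], and [- 2 u > 100 z], so [100 z x <= z^2]. *)
Lemma sqr_sub_neg (R : realType) (u x z : R) : 0 < z -> 0 <= x ->
  u < - (50 * z) -> (u - x) ^+ 2 - Num.min u 0 ^+ 2 <= z ^+ 2 -> x <= z / 100.
Proof.
move=> z0 x0 uz; rewrite min_l; last by lra.
move=> ux; rewrite -(@ler_pM2l _ (100 * z)); last by lra.
have : 100 * z * x <= - 2 * u * x by apply: ler_wpM2r => //; lra.
by have := sqr_ge0 x; rewrite !expr2 in ux *; lra.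
Qed.

(** With [U], [V] the positive parts, the residuals [w - x3], [U - x1], [V - x2] have squares
    summing to at most [z^2], and each quantity bounded is a signed sum of some of them. A
    coordinate below [- 50 z] drops out at a cost of [z / 100]: [57/40 = 283/200 + 1/100] and
    [51/50 = 1 + 2/100]. *)
Lemma feasible_faces (R : realType) (z u v w x1 x2 x3 : R) :
  0 < z -> 0 <= x1 -> 0 <= x2 ->
  (u - x1) ^+ 2 + (v - x2) ^+ 2 + (w - x3) ^+ 2 <=
    z ^+ 2 + (Num.min u 0 ^+ 2 + Num.min v 0 ^+ 2) ->
  let t := x1 + x2 - x3 in
  [/\ `|w + t - (Num.max u 0 + Num.max v 0)| <= 87 / 50 * z,
      v < - (50 * z) -> `|w + t - Num.max u 0| <= 57 / 40 * z,
      u < - (50 * z) -> `|w + t - Num.max v 0| <= 57 / 40 * z &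
      u < - (50 * z) -> v < - (50 * z) -> `|w + t| <= 51 / 50 * z].
Proof.
move=> z0 x10 x20 le t; have z0' := ltW z0.
have := sqr_sub_max _ u _ x10; have := sqr_sub_max _ v _ x20.
set U := Num.max u 0; set V := Num.max v 0 => Vle Ule.
have r0 := sqr_ge0 (w - x3); have U0 := sqr_ge0 (U - x1).
have V0 := sqr_ge0 (V - x2).
have xV : v < - (50 * z) -> x2 <= z / 100.
  by move=> vz; apply: (sqr_sub_neg _ v) => //; lra.
have xU : u < - (50 * z) -> x1 <= z / 100.
  by move=> uz; apply: (sqr_sub_neg _ u) => //; lra.
split.
- have -> : w + t - (U + V) = (w - x3) - (U - x1) - (V - x2) by rewrite /t; ring.
  by apply: sqr_sum3_le; rewrite ?sqrrN //; lra.
- move=> /xV x2z.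
  have /ler_normlP[] : `|(w - x3) - (U - x1)| <= 283 / 200 * z.
    by apply: sqr_sum2_le; rewrite ?sqrrN //; lra.
  by move=> ? ?; rewrite ler_norml /t; apply/andP; split; lra.
- move=> /xU x1z.
  have /ler_normlP[] : `|(w - x3) - (V - x2)| <= 283 / 200 * z.
    by apply: sqr_sum2_le; rewrite ?sqrrN //; lra.
  by move=> ? ?; rewrite ler_norml /t; apply/andP; split; lra.
- move=> /xU x1z /xV x2z.
  have /ler_normlP[] : `|w - x3| <= z.
    rewrite -(@ler_pXn2r _ 2)// ?nnegrE// real_normK ?num_real//; lra.
  by move=> ? ?; rewrite ler_norml /t; apply/andP; split; lra.
Qed.

(* Case analysis on the face of the orthant onto which [y] projects: a
   coordinate of [y] below [- 50 z] forces the corresponding coordinate of a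
   feasible point to be at most [z / 100].  Boundary points of the feasible set
   are only approximated, which costs [z / 1000] in each bound. *)
Lemma in_IRB_faces (R : realType) (z u v w : R) (h : 'cV[R]_3) :
  h 0 0 = 1 -> h 1 0 = 1 -> h 2 0 = - 1 -> 0 < z -> z <= 1 / 100 ->
  in_IRB z 1%:M h (vec3 (u, v, 1 + w)) (- 1) ->
  [/\ `|w - (Num.max u 0 + Num.max v 0)| <= 7 / 4 * z,
      v < - (50 * z) -> `|w - Num.max u 0| <= 143 / 100 * z,
      u < - (50 * z) -> `|w - Num.max v 0| <= 143 / 100 * z &
      u < - (50 * z) -> v < - (50 * z) -> `|w| <= 103 / 100 * z].
Proof.
move=> h0 h1 h2 z0 z1.
have e0 : 0 < z / 1000 by lra.
have feas x : rb_feasible z 1%:M (vec3 (u, v, 1 + w)) x ->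
    [/\ 0 <= x 0 0, 0 <= x 1 0, 0 <= x 2 0,
       (u - x 0 0) ^+ 2 + (v - x 1 0) ^+ 2 + (1 + w - x 2 0) ^+ 2 <=
       z ^+ 2 + (Num.min u 0 ^+ 2 + Num.min v 0 ^+ 2 + Num.min (1 + w) 0 ^+ 2) &
       dotv h x = x 0 0 + x 1 0 - x 2 0].
  move=> /rb_feasible_id[x0]; rewrite /dotv !big_ord_recl !big_ord0 !mxE /=.
  rewrite (_ : lift ord0 ord0 = 1); last exact/val_inj.
  rewrite (_ : lift ord0 (lift ord0 ord0) = 2); last exact/val_inj.
  rewrite !addr0 ?addrA h0 h1 h2 => xle.
  by split => //; rewrite ?mul1r ?mulN1r.
move=> /(in_IRB_approx _ _ _ _ _ _ _ _ _ e0)[[x /feas[x1 x2 x3 xz ->] hx]].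
move=> [x' /feas[x1' x2' x3' xz' ->] hx'].
(* A negative third coordinate of [y] would force [x 2 0 <= z], whereas [dotv h x < - 1 + z / 1000]
   makes [x 2 0] almost 1. *)
have w0 : 0 <= 1 + w.
  rewrite leNgt; apply/negP => w0.
  have := sqr_sub_max _ u _ x1; have := sqr_sub_max _ v _ x2.
  have := sqr_sub_max _ (1 + w) _ x3; rewrite max_r ?(ltW w0)// sub0r sqrrN.
  have := sqr_ge0 (Num.max u 0 - x 0 0); have := sqr_ge0 (Num.max v 0 - x 1 0).
  have : z ^+ 2 < x 2 0 ^+ 2 by rewrite ltr_pXn2r ?nnegrE//; lra.
  lra.
have mw : Num.min (1 + w) 0 = 0 by rewrite min_r.
rewrite mw expr0n addr0 in xz xz'.
(* The nearly maximal point [x'] bounds [w] from above, the nearly minimal point [x] from below. *)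
have [/ler_normlP[_ A1] A2 A3 A4] := feasible_faces _ _ _ _ _ _ _ _ z0 x1' x2' xz'.
have [/ler_normlP[B1 _] B2 B3 B4] := feasible_faces _ _ _ _ _ _ _ _ z0 x1 x2 xz.
split.
- by rewrite ler_norml; apply/andP; split; lra.
- move=> vz; have /ler_normlP[_ ?] := A2 vz; have /ler_normlP[? _] := B2 vz.
  by rewrite ler_norml; apply/andP; split; lra.
- move=> uz; have /ler_normlP[_ ?] := A3 uz; have /ler_normlP[? _] := B3 uz.
  by rewrite ler_norml; apply/andP; split; lra.
- move=> uz vz; have /ler_normlP[_ ?] := A4 uz vz.
  have /ler_normlP[? _] := B4 uz vz.
  by rewrite ler_norml; apply/andP; split; lra.
Qed.

(** * One-dimensional normal probabilities *)

Section ge0_integral_mono.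
Import HBNNSimple.

(* No measurability is assumed, so the coverage event need not be shown
   measurable. *)
Lemma ge0_integral_mono d (T : measurableType d) (R : realType)
    (mu : {measure set T -> \bar R}) (f g : T -> \bar R) :
  (forall x, 0 <= f x)%E -> (forall x, f x <= g x)%E ->
  (\int[mu]_x f x <= \int[mu]_x g x)%E.
Proof.
move=> f0 fg.
have g0 x : (0 <= g x)%E by exact: le_trans (fg x).
rewrite !ge0_integralTE//; apply: le_ereal_sup => _ [k kf <-].
by exists k => // x; exact: le_trans (kf x) (fg x).
Qed.

End ge0_integral_mono.

Section normal1.
Context {R : realType}.
Implicit Types (m s a b c z : R) (A B : set R).
Notation mu := (@lebesgue_measure R).

(** Stated for arbitrary sets so that it applies to sections of the coverage event. *)
Lemma normal_prob_mono m s A B :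
  A `<=` B -> (normal_prob m s A <= normal_prob m s B)%E.
Proof.
move=> AB; rewrite /normal_prob integral_mkcond [leRHS]integral_mkcond.
apply: ge0_integral_mono => x.
- by apply: erestrict_ge0 => y _; rewrite lee_fin normal_pdf_ge0.
- rewrite !patchE; case: ifPn => [/set_mem/AB/mem_set -> //|_].
  by case: ifPn => // _; rewrite lee_fin normal_pdf_ge0.
Qed.

Lemma measurable_normal_pdfE m s D :
  measurable_fun D (EFin \o normal_pdf m s).
Proof.
by apply/measurable_EFinP; apply: measurable_funTS; exact: measurable_normal_pdf.
Qed.

Lemma lebesgue_itvcc a b : a <= b -> mu `[a, b]%classic = (b - a)%:E.
Proof.
rewrite lebesgue_measure_itv /= lte_fin le_eqVlt => /predU1P[->|ab].
  by rewrite ltxx subrr.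
by rewrite ab EFinB.
Qed.

Lemma normal_prob_itv_le m s a b c A : a <= b -> A `<=` `[a, b]%classic ->
  (forall x, a <= x <= b -> normal_pdf m s x <= c) ->
  (normal_prob m s A <= ((b - a) * c)%:E)%E.
Proof.
move=> ab Aab pc; apply: le_trans (normal_prob_mono _ _ _ _ Aab) _.
apply: (@le_trans _ _ (\int[mu]_(x in `[a, b]) c%:E)%E).
  apply: ge0_le_integral => //=.
  - by move=> x _; rewrite lee_fin normal_pdf_ge0.
  - exact: measurable_normal_pdfE.
rewrite integral_cst//= lebesgue_itvcc//. by rewrite -EFinM mulrC.
Qed.

Lemma normal_prob_itv_ge m s a b c : a <= b -> 0 <= c ->
  (forall x, a <= x <= b -> c <= normal_pdf m s x) ->
  (((b - a) * c)%:E <= normal_prob m s `[a, b])%E.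
Proof.
move=> ab c0 pc.
rewrite /normal_prob; apply: (@le_trans _ _ (\int[mu]_(x in `[a, b]) c%:E)%E).
  by rewrite integral_cst//= lebesgue_itvcc// -EFinM mulrC.
apply: ge0_le_integral => //=.
exact: measurable_normal_pdfE.
Qed.

Lemma normal_prob_open_closed m s a :
  normal_prob m s `]a, +oo[ = normal_prob m s `[a, +oo[.
Proof.
by rewrite /normal_prob integral_itv_obnd_cbnd//; exact: measurable_normal_pdfE.
Qed.

Lemma normal_prob_sym s a : s != 0 ->
  normal_prob 0 s `]-oo, (- a)[ = normal_prob 0 s `]a, +oo[.
Proof.
move=> s0; rewrite normal_prob_open_closed /normal_prob.
rewrite integral_itv_bndo_bndc; last exact: measurable_normal_pdfE.
rewrite ge0_integration_by_substitutionNy//.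
- apply: eq_integral => x _ /=; rewrite !normal_pdfE//.
  by rewrite /normal_fun !subr0 sqrrN.
- by apply: continuous_subspaceT => x; exact: continuous_normal_pdf.
- by move=> x _; exact: normal_pdf_ge0.
Qed.

Lemma normal_prob_central s z : s != 0 -> 0 <= z ->
  (normal_prob 0%R s `[(- z)%R, z] + 2%:E * normal_prob 0%R s `]z, +oo[ = 1)%E.
Proof.
move=> s0 z0.
have <- : normal_prob 0 s setT = 1%E by exact: probability_setT.
have -> : [set: R] =
    (`]-oo, (- z)[ `|` (`[(- z), z] `|` `]z, +oo[))%classic.
  apply/esym/seteqP; split => // x _ /=; rewrite !in_itv/= andbT.
  case: (ltP x (- z)) => xz; [by left|right].
  by case: (leP x z) => xz'; [left|right].
rewrite !measureU//; first last.
- apply/seteqP; split => // x [] /=; rewrite !in_itv/= => xz [/andP[]|]; lra.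
- exact: measurableU.
- by apply/seteqP; split => // x [] /=; rewrite !in_itv/= => /andP[]; lra.
rewrite [X in _ = (X + _)%E]normal_prob_sym// mule_natl mule2n.
by rewrite addeCA.
Qed.

(** The case [z = 0] of the central identity, where the middle interval is a null point. *)
Lemma normal_prob_half s : s != 0 ->
  normal_prob 0 s `]-oo, 0[ = (1 / 2)%:E /\ normal_prob 0 s `[0, +oo[ = (1 / 2)%:E.
Proof.
move=> s0; have := normal_prob_central s 0 s0 (lexx 0).
have -> : normal_prob 0 s `[(- 0), 0] = 0%E.
  by rewrite oppr0 set_itv1 /normal_prob integral_set1.
have := normal_prob_sym s 0 s0; rewrite oppr0 => ->.
rewrite -normal_prob_open_closed.
have : (normal_prob 0 s `]0%R, +oo[ \is a fin_num)%E by exact: fin_num_measure.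
case: (normal_prob _ _ _) => // r _; rewrite add0e -EFinM => -[e].
by split; congr EFin; lra.
Qed.

(** Radon-Nikodym change of variables; the bound [c] makes [f] integrable. *)
Lemma normal_prob_dens m s (f : R -> R) c : (forall x, 0 <= f x <= c) ->
  measurable_fun setT f ->
  (\int[normal_prob m s]_x (f x)%:E =
   \int[mu]_x (f x * normal_pdf m s x)%:E)%E.
Proof.
move=> fc mf; have dom := @normal_prob_dominates R m s.
have intf : (normal_prob m s).-integrable setT (EFin \o f).
  apply/integrableP; split; first exact/measurable_EFinP.
  apply: (@le_lt_trans _ _ (\int[normal_prob m s]_x c%:E)%E).
    apply: ge0_integral_mono => // x /=.
    by case/andP: (fc x) => f0 fle; rewrite lee_fin ger0_norm.
  by rewrite integral_cst//= probability_setT mule1 ltry.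
rewrite -(Radon_Nikodym_change_of_variables dom)//=.
apply: ae_eq_integral => //.
- apply: emeasurable_funM; first exact/measurable_EFinP.
  by apply: (measurable_int mu); exact: Radon_Nikodym_integrable.
- apply/measurable_EFinP; apply: measurable_funM => //.
  exact: measurable_normal_pdf.
under [X in ae_eq _ _ _ X]eq_fun do rewrite EFinM.
apply: ae_eqe_mul2l => /=.
(* The abstract derivative and the density have equal integrals over every measurable set, hence
   agree almost everywhere. *)
rewrite Radon_NikodymE.
case: cid => /= h [h1 h2 h3].
apply: integral_ae_eq => //=.
- exact: measurable_normal_pdfE.
- by move=> E _ mE; rewrite -h3.
Qed.

End normal1.

(** * The difference of two independent normal variables *)

Section normal2.
Context {R : realType}.
Implicit Types (s a u x z : R).
Notation mu := (@lebesgue_measure R).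

Lemma normal_peak_scale s : 0 < s -> normal_peak s = s^-1 * normal_peak 1.
Proof.
move=> s0; rewrite /normal_peak expr1n mul1r -mulrnAr sqrtrM ?sqr_ge0//.
by rewrite sqrtr_sqr gtr0_norm// invfM.
Qed.

(** Completing the square. For independent [X], [Y] of mean [a] and [U = (Y - X) / sqrt 2], the
    joint density of [X] and [U] is the standard normal density of [U] times the conditional density
    of [X]; the leading [sqrt 2] is the Jacobian. *)
Lemma normal_pdf_mul a u x :
  Num.sqrt 2 * normal_pdf a 1 (x + Num.sqrt 2 * u) * normal_pdf a 1 x =
  normal_pdf 0 1 u * normal_pdf (a - u * (Num.sqrt 2 / 2)) (Num.sqrt 2 / 2) x.
Proof.
have r0 : 0 < Num.sqrt 2 :> R by rewrite sqrtr_gt0.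
have r2 : Num.sqrt 2 * Num.sqrt 2 = 2 :> R by rewrite -expr2 sqr_sqrtr.
set r := Num.sqrt 2 in r0 r2 *.
have s0 : 0 < r / 2 by rewrite divr_gt0.
rewrite !normal_pdfE ?oner_eq0 ?gt_eqF// (normal_peak_scale _ s0).
rewrite [LHS](_ : _ = r * normal_peak 1 * normal_peak 1 *
  (normal_fun a 1 (x + r * u) * normal_fun a 1 x)); last by ring.
rewrite [RHS](_ : _ = (r / 2)^-1 * normal_peak 1 * normal_peak 1 *
  (normal_fun 0 1 u * normal_fun (a - u * (r / 2)) (r / 2) x)); last by ring.
congr (_ * _ * _ * _).
  by rewrite invf_div; apply: (mulIf (lt0r_neq0 r0)); rewrite r2 divfK ?gt_eqF.
rewrite /normal_fun -!expRD; congr expR.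
have -> : (r / 2) ^+ 2 *+ 2 = 1 by rewrite expr2 mulr2n; lra.
rewrite expr1n divr1 subr0.
have -> : (x + r * u - a) ^+ 2 = (x - a) ^+ 2 + 2 * r * u * (x - a) + (r * r) * u ^+ 2.
  by ring.
have -> : (x - (a - u * (r / 2))) ^+ 2 =
    (x - a) ^+ 2 + r * u * (x - a) + (r * r) * u ^+ 2 / 4 by field.
by rewrite r2; field.
Qed.

Lemma normal_prob_subst a x z : 0 <= z ->
  normal_prob a 1 `[x - Num.sqrt 2 * z, x + Num.sqrt 2 * z] =
  (\int[mu]_(u in `[(- z)%R, z])
     (Num.sqrt 2 * normal_pdf a 1 (x + Num.sqrt 2 * u))%:E)%E.
Proof.
move=> z0; rewrite /normal_prob; set r := Num.sqrt 2.
have r0 : 0 < r by rewrite sqrtr_gt0.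
pose F (u : R^o) : R^o := x + r * u.
have dF (u : R^o) : derivable F u 1.
  by apply: derivableD => //; exact: derivableM.
have F'E : (F^`())%classic = cst r.
  apply/funext => u; rewrite /F derive1E deriveD// derive_cst add0r.
  by rewrite deriveM// derive_cst scaler0 addr0 derive_id; exact: mulr1.
have -> : x - r * z = F (- z) by rewrite /F mulrN.
have -> : x + r * z = F z by [].
rewrite (@integration_by_substitution_increasing R F) ?F'E//.
- by apply: eq_integral => u _ /=; rewrite mulrC.
- lra.
- by move=> u v _ _ uv; rewrite /F ltrD2l ltr_pM2l.
- by move=> u _; exact: cvg_cst.
- exact: is_cvg_cst.
- exact: is_cvg_cst.
- have cF : continuous F.
    by move=> u; apply: differentiable_continuous; exact/derivable1_diffP.
  split.
  + by move=> u _; exact: dF.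
  + by apply: cvg_at_right_filter; exact: cF.
  + by apply: cvg_at_left_filter; exact: cF.
- by apply: continuous_subspaceT => u; apply: continuous_normal_pdf; rewrite oner_eq0.
Qed.

(** Slice at [x], substitute [y = x + sqrt 2 u], exchange the integrals, and integrate out the
    conditional density of [x], which has mass 1. *)
Lemma normal_diff_strip a z : 0 <= z ->
  product_measure1 (normal_prob a 1) (normal_prob a 1)
    [set y : R * R | (y.1 - y.2) ^+ 2 <= 2 * z ^+ 2] =
  normal_prob 0 1 `[(- z), z].
Proof.
move=> z0; set r := Num.sqrt (2 : R).
have r0 : 0 < r by rewrite sqrtr_gt0.
have r2 : r * r = 2 by rewrite -expr2 sqr_sqrtr.
pose k (p : R * R) : R :=
  r * normal_pdf a 1 (p.1 + r * p.2) * \1_(`[(- z), z]%classic) p.2.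
have mk : measurable_fun setT k.
  apply: measurable_funM.
    apply: measurable_funM => //; apply: measurableT_comp => //.
      exact: measurable_normal_pdf.
    by apply: measurable_funD => //; exact: measurable_funM.
  by apply: measurableT_comp => //; exact: measurable_indic.
have k0 p : 0 <= k p.
  by rewrite /k mulr_ge0 ?mulr_ge0 ?normal_pdf_ge0 ?(ltW r0).
transitivity (\int[normal_prob a 1]_x \int[mu]_u (k (x, u))%:E)%E.
  apply: eq_integral => x _ /=.
  transitivity (normal_prob a 1 `[x - r * z, x + r * z]).
    congr (normal_prob a 1 _); apply/seteqP.
    have e (y : R) : ((x - y) ^+ 2 <= 2 * z ^+ 2) = (x - r * z <= y <= x + r * z).
      rewrite -r2 -expr2 -exprMn -[X in X <= _]real_normK ?num_real//.
      rewrite ler_pXn2r ?nnegrE ?mulr_ge0 ?(ltW r0)// ler_norml.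
      by apply/andP/andP => -[? ?]; split; lra.
    split => y; rewrite /xsection /= in_itv/= -e.
      by move=> /set_mem.
    by move=> ?; exact/mem_set.
  rewrite normal_prob_subst// integral_mkcond; apply: eq_integral => u _.
  rewrite patchE /k /= indicE; by case: ifPn => _; rewrite ?mulr1 ?mulr0.
have mEk : measurable_fun setT (EFin \o k) by exact/measurable_EFinP.
have Ek0 p : (0 <= (EFin \o k) p)%E by rewrite lee_fin.
rewrite (@fubini_tonelli _ _ _ _ _ (normal_prob a 1) mu _ mEk Ek0).
rewrite [RHS]/normal_prob [RHS]integral_mkcond; apply: eq_integral => u _.
rewrite /fubini_G /= (@normal_prob_dens _ _ _ _ (r * normal_peak 1)).
- rewrite patchE; under eq_integral => x _.
    rewrite /k /= mulrAC normal_pdf_mul mulrAC EFinM; over.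
  rewrite ge0_integralZl//; last 3 first.
  + exact: measurable_normal_pdfE.
  + by move=> x _; rewrite lee_fin normal_pdf_ge0.
  + by rewrite lee_fin mulr_ge0 ?normal_pdf_ge0.
  rewrite integral_normal_pdf mule1 indicE.
  by case: ifPn => _; rewrite ?mulr1 ?mulr0.
- move=> x; rewrite k0 /k /=; apply: (@le_trans _ _ (r * normal_pdf a 1 (x + r * u))).
    by rewrite ler_piMr ?mulr_ge0 ?normal_pdf_ge0 ?(ltW r0)// indicE lern1 leq_b1.
  by rewrite ler_pM2l// normal_pdf_ub.
- exact: (measurableT_comp mk (pair2_measurable u)).
Qed.

End normal2.

(** * Upper bounds on means *)

Section mean_le.
Context {R : realType}.

(** Measurability and nonnegativity are bundled with the bound so that estimates combine through
    sums, multiples and products of independent factors. *)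
Definition mean_le {d} {T : measurableType d} (mu : set T -> \bar R)
    (f : T -> R) (c : R) :=
  [/\ measurable_fun setT f, (forall x, 0 <= f x) &
      (\int[mu]_x (f x)%:E <= c%:E)%E].

Lemma mean_leD d (T : measurableType d) (mu : {measure set T -> \bar R})
    (f g : T -> R) (a b : R) :
  mean_le mu f a -> mean_le mu g b -> mean_le mu (fun x => f x + g x) (a + b).
Proof.
move=> [mf f0 fa] [mg g0 gb]; split.
- exact: measurable_funD.
- by move=> x; exact: addr_ge0.
- under eq_integral do rewrite EFinD.
  rewrite ge0_integralD//; first by rewrite EFinD leeD.
  + by move=> x _; rewrite lee_fin.
  + exact/measurable_EFinP.
  + by move=> x _; rewrite lee_fin.
  + exact/measurable_EFinP.
Qed.

Lemma mean_leZ d (T : measurableType d) (mu : {measure set T -> \bar R})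
    (f : T -> R) (k a : R) :
  0 <= k -> mean_le mu f a -> mean_le mu (fun x => k * f x) (k * a).
Proof.
move=> k0 [mf f0 fa]; split.
- exact: measurable_funM.
- by move=> x; exact: mulr_ge0.
- under eq_integral do rewrite EFinM.
  rewrite ge0_integralZl//; first by rewrite EFinM lee_wpmul2l.
  + exact/measurable_EFinP.
  + by move=> x _; rewrite lee_fin.
Qed.

(** By Tonelli the integral of the product factors. *)
Lemma mean_leM d1 d2 (T1 : measurableType d1) (T2 : measurableType d2)
    (mu1 : {sigma_finite_measure set T1 -> \bar R})
    (mu2 : {sigma_finite_measure set T2 -> \bar R})
    (f : T1 -> R) (g : T2 -> R) (a b : R) :
  mean_le mu1 f a -> mean_le mu2 g b ->
  mean_le (product_measure1 mu1 mu2) (fun x => f x.1 * g x.2) (a * b).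
Proof.
move=> [mf f0 fa] [mg g0 gb].
have mfg : measurable_fun setT (fun x : T1 * T2 => f x.1 * g x.2).
  by apply: measurable_funM; apply: measurableT_comp.
split => //; first by move=> x; exact: mulr_ge0.
rewrite fubini_tonelli1.
- under eq_integral => x _.
    rewrite /fubini_F /=; under eq_integral do rewrite EFinM.
    rewrite ge0_integralZl//; last 3 first.
    - exact/measurable_EFinP.
    - by move=> y _; rewrite lee_fin.
    - by rewrite lee_fin.
    over.
  rewrite ge0_integralZr//.
  + rewrite EFinM; apply: lee_pmul => //; apply: integral_ge0 => x _.
      by rewrite lee_fin.
    by rewrite lee_fin.
  + exact/measurable_EFinP.
  + by move=> x _; rewrite lee_fin.
  + by apply: integral_ge0 => x _; rewrite lee_fin.
- exact/measurable_EFinP.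
- by move=> x; rewrite lee_fin mulr_ge0.
Qed.

Lemma mean_le_indic d (T : measurableType d) (mu : {measure set T -> \bar R})
    (A : set T) (a : R) :
  measurable A -> (mu A <= a%:E)%E -> mean_le mu \1_A a.
Proof.
move=> mA Aa; split.
- exact: measurable_indic.
- by move=> x; rewrite indicE.
- by rewrite integral_indic// setIT.
Qed.

End mean_le.

(** * Means of the Gaussian weights and indicators in the conditional bound *)

Section normal3.
Context {R : realType}.
Implicit Types (m s c z : R).
Notation mu := (@lebesgue_measure R).
Notation p := (@normal_peak R 1).

Lemma normal_pdf1E m x :
  normal_pdf m 1 x = p * expR (- (x - m) ^+ 2 / 2) :> R.
Proof. by rewrite normal_pdfE ?oner_eq0// /normal_fun expr1n. Qed.

(** The exponent [12/25], slightly below [1/2], leaves room to absorb a displacement of the argument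
    of the density. *)
Definition damp (y : R) : R := \1_(`[0, +oo[%classic) y * expR (- (12 / 25 * y ^+ 2)).

(* [49/50 = 12/25 + 1/2 = 1 / (2 (5/7)^2)], so the damped standard normal
   density is [5/7] times the density of standard deviation [5/7]. *)
Lemma mean_le_damp : mean_le (normal_prob 0 1) damp (5 / 14).
Proof.
have md : measurable_fun setT damp.
  apply: measurable_funM; first exact: measurable_indic.
  apply: measurableT_comp => //; apply: measurableT_comp => //.
  by apply: measurable_funM => //; exact: measurable_funX.
have d0 x : 0 <= damp x by rewrite mulr_ge0 ?indicE ?expR_ge0.
split => //.
rewrite (@normal_prob_dens _ _ _ _ 1)//; last first.
  move=> x; rewrite d0 /damp indicE; case: (_ \in _); last by rewrite mul0r ler01.
  rewrite mul1r andTb.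
  by rewrite -[leRHS]expR0 ler_expR oppr_le0 mulr_ge0 ?sqr_ge0.
have s0 : 0 < 5 / 7 :> R by lra.
have [_ half] := normal_prob_half _ (lt0r_neq0 s0).
rewrite (_ : 5 / 14 = 5 / 7 * (1 / 2) :> R); last by field.
rewrite [leRHS]EFinM -half /normal_prob [X in (_ * X)%E]integral_mkcond.
rewrite -ge0_integralZl//.
- apply: ge0_integral_mono => x; first by rewrite lee_fin mulr_ge0 ?normal_pdf_ge0.
  rewrite patchE /damp indicE; case: (_ \in _); last first.
    by rewrite !mul0r mule0.
  rewrite -EFinM lee_fin mul1r normal_pdf1E normal_pdfE ?gt_eqF//.
  rewrite (normal_peak_scale _ s0) /normal_fun mulrCA -expRD.
  rewrite -[_^-1 * _ * _]mulrA mulVKf ?gt_eqF// ler_pM2l ?normal_peak_gt0// ler_expR.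
  by rewrite subr0 mulr2n le_eqVlt; apply/orP; left; apply/eqP; field.
- apply/(measurable_restrictT _ _).1 => //.
  exact: measurable_normal_pdfE.
- by move=> x _; apply: erestrict_ge0 => y _; rewrite lee_fin normal_pdf_ge0.
Qed.

Lemma mean_le_neg : mean_le (normal_prob 0 1) \1_(`]-oo, (0 : R)[%classic) (1 / 2).
Proof.
apply: mean_le_indic => //.
by have [<- _] := @normal_prob_half R 1 (oner_neq0 _).
Qed.

Lemma mean_le_near0 z : 0 <= z ->
  mean_le (normal_prob 0 1) \1_(`[- (50 * z), 0[%classic) (50 * z * p).
Proof.
move=> z0; apply: mean_le_indic => //.
apply: le_trans (normal_prob_itv_le 0 1 (- (50 * z)) 0 p _ _ _ _) _.
- by rewrite oppr_le0 mulr_ge0.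
- by move=> x /=; rewrite !in_itv/= => /andP[-> /ltW].
- by move=> x _; apply: normal_pdf_ub; rewrite oner_eq0.
- by rewrite sub0r opprK.
Qed.

(* [(s + t)^2 / 2 - 12/25 s^2 + 12 t^2 = (s + 25 t)^2 / 50]. *)
Lemma normal_pdf_shift_le m s c x : `|x - m - s| <= c ->
  normal_pdf m 1 x <= p * (expR (12 * c ^+ 2) * expR (- (12 / 25 * s ^+ 2))).
Proof.
move=> xc; rewrite normal_pdf1E ler_pM2l ?normal_peak_gt0 ?oner_eq0//.
rewrite -expRD ler_expR.
have tc : (x - m - s) ^+ 2 <= c ^+ 2.
  by rewrite -[X in X <= _]real_normK ?num_real// ler_pXn2r ?nnegrE ?(le_trans _ xc).
have := sqr_ge0 (s + 25 * (x - m - s)); rewrite !expr2 in tc *; lra.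
Qed.

End normal3.

(** * Conditional coverage given the first two coordinates *)

Section section_bound.
Context {R : realType}.
Implicit Types (m s c b z u v x y : R) (A : set R).
Notation p := (@normal_peak R 1).

Lemma normal_prob_ball_le m s c b A : 0 <= c ->
  (forall x, A x -> `|x - m - s| <= c) ->
  (forall x, `|x - m - s| <= c -> normal_pdf m 1 x <= b) ->
  (normal_prob m 1 A <= (2 * c * b)%:E)%E.
Proof.
move=> c0 Ac cb.
have -> : 2 * c * b = ((m + s + c) - (m + s - c)) * b by ring.
apply: normal_prob_itv_le; first lra.
  move=> x /Ac /ler_normlP[? ?]; rewrite /= in_itv/=; apply/andP; split; lra.
by move=> x /andP[? ?]; apply: cb; rewrite ler_norml; apply/andP; split; lra.
Qed.

(* One summand for each face of the orthant, then the slabs on which [u] or [v]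
   lies in [- 50 z, 0[, where only the bound [7/2 p z] is used. *)
Definition sec_bound (z : R) (y : R * R) : R :=
  let neg : R -> R := \1_(`]-oo, 0[%classic) in
  let near0 : R -> R := \1_(`[- (50 * z), 0[%classic) in
  let K := expR (48 * z ^+ 2) in (* [48 z^2 = 12 (2 z)^2 >= 12 c^2] *)
  2 * p * z *
    (7 / 4 * K * (damp y.1 * damp y.2) +
     143 / 100 * K * (damp y.1 * neg y.2) +
     143 / 100 * K * (neg y.1 * damp y.2) +
     103 / 100 * (neg y.1 * neg y.2) +
     2 * (near0 y.1 * \1_[set: R] y.2) + 2 * (\1_[set: R] y.1 * near0 y.2)).

(** Given [(u, v)], coverage confines the third coordinate to an interval of length [2 c] dictated
    by the face, on which the density is bounded; the cases are the signs of [u], [v] and the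
    slabs. *)
Lemma section_le (z u v : R) (h : 'cV[R]_3) :
  h 0 0 = 1 -> h 1 0 = 1 -> h 2 0 = - 1 -> 0 < z -> z <= 1 / 100 ->
  (normal_prob 1 1 [set y | in_IRB z 1%:M h (vec3 ((u, v), y)) (- 1)%R] <=
   (sec_bound z (u, v))%:E)%E.
Proof.
move=> h0 h1 h2 z0 z1; set A := [set _ | _].
have p0 : 0 < p by rewrite normal_peak_gt0// oner_eq0.
set K := expR (48 * z ^+ 2).
have K0 : 0 < K by exact: expR_gt0.
have faces y : A y ->
    [/\ `|y - 1 - (Num.max u 0 + Num.max v 0)| <= 7 / 4 * z,
        v < - (50 * z) -> `|y - 1 - Num.max u 0| <= 143 / 100 * z,
        u < - (50 * z) -> `|y - 1 - Num.max v 0| <= 143 / 100 * z &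
        u < - (50 * z) -> v < - (50 * z) -> `|y - 1 - 0| <= 103 / 100 * z].
  move=> Ay; rewrite subr0; apply: (in_IRB_faces _ z u v (y - 1) h) => //.
  by rewrite addrC subrK.
have pK s c x : 0 <= c -> c <= 7 / 4 * z -> `|x - 1 - s| <= c ->
    normal_pdf 1 1 x <= p * (K * expR (- (12 / 25 * s ^+ 2))).
  move=> c0 cz xs; apply: le_trans (normal_pdf_shift_le _ _ _ _ xs) _.
  rewrite ler_pM2l// ler_wpM2r ?expR_ge0// ler_expR.
  have : c ^+ 2 <= (7 / 4 * z) ^+ 2 by rewrite ler_pXn2r ?nnegrE// ?mulr_ge0// ltW.
  by have := sqr_ge0 z; rewrite !expr2; lra.
have pp s c x : `|x - 1 - s| <= c -> normal_pdf 1 1 x <= p.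
  by move=> _; apply: normal_pdf_ub; rewrite oner_eq0.
have damp_ge0 y : 0 <= y -> damp y = expR (- (12 / 25 * y ^+ 2)).
  by move=> y0; rewrite /damp indicE mem_set ?mul1r//= in_itv/= andbT.
have damp_lt0 y : y < 0 -> damp y = 0.
  move=> y0; rewrite /damp indicE memNset ?mul0r//= in_itv/= andbT.
  by apply/negP; rewrite -ltNge.
have neg_ge0 y : 0 <= y -> \1_(`]-oo, (0 : R)[%classic) y = 0 :> R.
  by move=> y0; rewrite indicE memNset//= in_itv/=; apply/negP; rewrite -leNgt.
have neg_lt0 y : y < 0 -> \1_(`]-oo, (0 : R)[%classic) y = 1 :> R.
  by move=> y0; rewrite indicE mem_set//= in_itv.
have near_ge0 y : 0 <= y -> \1_(`[- (50 * z), (0 : R)[%classic) y = 0 :> R.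
  move=> y0; rewrite indicE memNset//= in_itv/=; apply/negP.
  by rewrite negb_and -leNgt y0 orbT.
have near_in y : - (50 * z) <= y -> y < 0 ->
    \1_(`[- (50 * z), (0 : R)[%classic) y = 1 :> R.
  by move=> y1 y0; rewrite indicE mem_set//= in_itv/= y1.
have near_out y : y < - (50 * z) -> \1_(`[- (50 * z), (0 : R)[%classic) y = 0 :> R.
  move=> y0; rewrite indicE memNset//= in_itv/=.
  by apply/negP; rewrite negb_and -ltNge y0.
have near_pos y : 0 <= \1_(`[- (50 * z), (0 : R)[%classic) y :> R by rewrite indicE.
have pz : 0 <= 2 * p * z by rewrite !mulr_ge0// ltW.
(* Crude bound valid for all [u], [v]; it settles the slabs because [7/4 <= 2]. *)
have bd : (normal_prob 1 1 A <= (2 * (7 / 4 * z) * p)%:E)%E.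
  apply: (@normal_prob_ball_le _ (Num.max u 0 + Num.max v 0)); first lra.
    by move=> x /faces[+ _ _ _]; exact.
  exact: pp.
have bd_le (t : R) : 2 <= t -> (normal_prob 1 1 A <= (2 * p * z * t)%:E)%E.
  move=> t2; apply: le_trans bd _; rewrite lee_fin.
  rewrite (_ : 2 * (7 / 4 * z) * p = 2 * p * z * (7 / 4)); last by ring.
  by apply: ler_wpM2l => //; lra.
rewrite /sec_bound /= -/K !indicT /cst.
have [u0|u0] := leP 0 u; have [v0|v0] := leP 0 v.
- rewrite !damp_ge0 ?neg_ge0 ?near_ge0// !(mulr0, mul0r, addr0).
  apply: (@le_trans _ _
    (2 * (7 / 4 * z) * (p * (K * expR (- (12 / 25 * (u + v) ^+ 2)))))%:E).
    apply: (@normal_prob_ball_le _ (u + v)); first lra.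
      by move=> x /faces[]; rewrite !max_l.
    by move=> x; apply: pK; lra.
  rewrite lee_fin -expRD.
  rewrite [leLHS](_ : _ =
    2 * p * z * (7 / 4 * K * expR (- (12 / 25 * (u + v) ^+ 2)))); last by ring.
  apply: ler_wpM2l => //; apply: ler_wpM2l; first by rewrite mulr_ge0 ?(ltW K0).
  (* Here [(u + v)^2 >= u^2 + v^2] turns the weight into a product. *)
  by rewrite ler_expR; have := mulr_ge0 u0 v0; rewrite !expr2; lra.
- have [vz|vz] := ltP v (- (50 * z)); last first.
    apply: bd_le; rewrite damp_ge0// (damp_lt0 v)// (neg_ge0 u)// (neg_lt0 v)//.
    rewrite (near_ge0 u)// (near_in v)// !(mulr0, mul0r, addr0, mulr1, add0r).
    by rewrite lerDr mulr_ge0 ?expR_ge0// mulr_ge0 ?(ltW K0).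
  rewrite damp_ge0// (damp_lt0 v)// (neg_ge0 u)// (neg_lt0 v)//.
  rewrite (near_ge0 u)// (near_out v)// !(mulr0, mul0r, addr0, mulr1, add0r).
  apply: (@le_trans _ _
    (2 * (143 / 100 * z) * (p * (K * expR (- (12 / 25 * u ^+ 2)))))%:E).
    apply: (@normal_prob_ball_le _ (u)); first lra.
      by move=> x /faces[_ + _ _]; rewrite max_l//; exact.
    by move=> x; apply: pK; lra.
  by rewrite lee_fin le_eqVlt; apply/orP; left; apply/eqP; ring.
- have [uz|uz] := ltP u (- (50 * z)); last first.
    apply: bd_le; rewrite (damp_ge0 v)// (damp_lt0 u)// (neg_ge0 v)// (neg_lt0 u)//.
    rewrite (near_ge0 v)// (near_in u)// !(mulr0, mul0r, addr0, mulr1, add0r, mul1r).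
    by rewrite lerDr mulr_ge0 ?expR_ge0// mulr_ge0 ?(ltW K0).
  rewrite (damp_ge0 v)// (damp_lt0 u)// (neg_ge0 v)// (neg_lt0 u)//.
  rewrite (near_ge0 v)// (near_out u)// !(mulr0, mul0r, addr0, mulr1, add0r, mul1r).
  apply: (@le_trans _ _
    (2 * (143 / 100 * z) * (p * (K * expR (- (12 / 25 * v ^+ 2)))))%:E).
    apply: (@normal_prob_ball_le _ (v)); first lra.
      by move=> x /faces[_ _ + _]; rewrite (max_l v0)//; exact.
    by move=> x; apply: pK; lra.
  by rewrite lee_fin le_eqVlt; apply/orP; left; apply/eqP; ring.
- rewrite !damp_lt0// !neg_lt0// !(mulr0, mul0r, addr0, mulr1, add0r, mul1r).
  have [uz|uz] := ltP u (- (50 * z)); last first.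
    by apply: bd_le; rewrite (near_in u)//; have := near_pos v; lra.
  have [vz|vz] := ltP v (- (50 * z)); last first.
    by apply: bd_le; rewrite (near_in v)//; have := near_pos u; lra.
  rewrite !near_out// !(mulr0, addr0).
  apply: (@le_trans _ _ (2 * (103 / 100 * z) * p)%:E).
    apply: (@normal_prob_ball_le _ (0)); first lra.
      by move=> x /faces[_ _ _ +]; exact.
    exact: pp.
  by rewrite lee_fin le_eqVlt; apply/orP; left; apply/eqP; ring.
Qed.

End section_bound.

(** * Coverage probabilities *)

Lemma mean_le_sec_bound (R : realType) (z : R) : 0 < z ->
  let p : R := normal_peak 1 in let K := expR (48 * z ^+ 2) in
  mean_le (product_measure1 (normal_prob (0 : R) 1) (normal_prob (0 : R) 1))
    (sec_bound z)
    (2 * p * z * (7 / 4 * K * (5 / 14 * (5 / 14)) +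
       143 / 100 * K * (5 / 14 * (1 / 2)) + 143 / 100 * K * (1 / 2 * (5 / 14)) +
       103 / 100 * (1 / 2 * (1 / 2)) +
       2 * (50 * z * p * 1) + 2 * (1 * (50 * z * p)))).
Proof.
move=> z0 p K.
have p0 : 0 <= p by exact: normal_peak_ge0.
have K0 : 0 <= K by exact: expR_ge0.
have m1 : mean_le (normal_prob (0 : R) 1) \1_[set: R] 1.
  by apply: mean_le_indic => //; exact: probability_le1.
have mg := @mean_le_damp R; have mn := @mean_le_neg R.
have mb := mean_le_near0 _ (ltW z0).
apply: mean_leZ; first by rewrite !mulr_ge0// ltW.
(* The summands are peeled off from the last to the first, each a product of independent factors. *)
apply: mean_leD; last first.
  by apply: mean_leZ => //; exact: mean_leM.
apply: mean_leD; last first.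
  by apply: mean_leZ => //; exact: mean_leM.
apply: mean_leD; last first.
  by apply: mean_leZ; [lra|exact: mean_leM].
apply: mean_leD; last first.
  by apply: mean_leZ; [rewrite mulr_ge0//; lra|exact: mean_leM].
apply: mean_leD; last first.
  by apply: mean_leZ; [rewrite mulr_ge0//; lra|exact: mean_leM].
by apply: mean_leZ; [rewrite mulr_ge0//; lra|exact: mean_leM].
Qed.

(** Since [pi >= 2], [sqrt (2 pi) >= 2]. *)
Lemma normal_peak1_le (R : realType) : normal_peak 1 <= 1 / 2 :> R.
Proof.
have pi2 := pi_ge2 R.
rewrite /normal_peak expr1n mul1r mul1r.
have le2 : 2 <= Num.sqrt (pi *+ 2) :> R.
  rewrite -(@ler_pXn2r _ 2)// ?nnegrE ?sqrtr_ge0// sqr_sqrtr; last first.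
    by rewrite mulrn_wge0// (le_trans _ pi2).
  by rewrite expr2 mulr2n; lra.
by rewrite lef_pV2 ?posrE// (lt_le_trans _ le2).
Qed.

(** A negative [z] would have upper tail at least [1/2 > alpha / 2]. *)
Lemma upper_quantile_ge0 (R : realType) (alpha z : R) :
  alpha < 1 -> is_upper_quantile alpha z -> 0 <= z.
Proof.
move=> a1 q; rewrite leNgt; apply/negP => z0.
have [_ half] := @normal_prob_half R 1 (oner_neq0 _).
have : (normal_prob (0 : R) 1 `[0%R, +oo[ <= normal_prob (0 : R) 1 `]z, +oo[)%E.
  apply: normal_prob_mono => x /=; rewrite !in_itv/= !andbT.
  exact: lt_le_trans.
by rewrite half q lee_fin; lra.
Qed.

Lemma upper_quantileE (R : realType) (alpha z : R) : 0 <= z ->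
  is_upper_quantile alpha z <-> normal_prob 0 1 `[(- z), z] = (1 - alpha)%:E.
Proof.
move=> z0; rewrite /is_upper_quantile.
have := @normal_prob_central R 1 z (oner_neq0 _) z0.
have : (normal_prob 0%R 1 `]z, +oo[ \is a fin_num)%E by exact: fin_num_measure.
have : (normal_prob 0%R 1 `[(- z)%R, z] \is a fin_num)%E by exact: fin_num_measure.
case: (normal_prob _ _ `[_, _]) => // r _; case: (normal_prob _ _ _) => // t _.
by rewrite -EFinM -EFinD => -[e]; split=> -[e']; congr EFin; lra.
Qed.

Theorem theorem4p1 (R : realType) :
  (* (a) K = I_2, h = (1,-1), x* = (a,a), any a >= 0, every alpha in (0,1) *)
  (forall (a alpha z : R), 0 <= a -> 0 < alpha < 1 -> is_upper_quantile alpha z ->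
     let K : 'M[R]_2 := 1%:M in
     let h : 'cV[R]_2 := \col_(i < 2) [:: 1; -1]`_i in
     let xs : 'cV[R]_2 := \col_(i < 2) [:: a; a]`_i in
     ((1 - alpha)%:E <=
        gauss2 (K *m xs) [set y | in_IRB z K h (vec2 y) (dotv h xs)])%E)
  /\
  (* (b) K = I_3, h = (1,1,-1), x* = (0,0,1): some alpha in (0,1) fails *)
  (let K : 'M[R]_3 := 1%:M in
   let h : 'cV[R]_3 := \col_(i < 3) [:: 1; 1; -1]`_i in
   let xs : 'cV[R]_3 := \col_(i < 3) [:: 0; 0; 1]`_i in
   exists alpha z : R, 0 < alpha < 1 /\ is_upper_quantile alpha z /\
     (gauss3 (K *m xs) [set y | in_IRB z K h (vec3 y) (dotv h xs)]
        < (1 - alpha)%:E)%E).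
Proof.
split.
- move=> a alpha z _ /andP[_ a1] qz; cbv zeta.
  set h := \col_i [:: 1; -1]`_i; set xs := \col_i [:: a; a]`_i.
  have z0 := upper_quantile_ge0 _ _ _ a1 qz.
  move/(upper_quantileE _ _ _ z0) : qz => <-.
  have -> : dotv h xs = 0.
    by rewrite /dotv !big_ord_recl big_ord0 !mxE /=; ring.
  (* The target becomes the probability of the strip, which lies inside the coverage event section
     by section. *)
  rewrite -(normal_diff_strip a z z0) /gauss2 mul1mx !mxE /=.
  apply: ge0_integral_mono => x; first exact: measure_ge0.
  apply: normal_prob_mono => y; rewrite /xsection /= !inE /= => xy.
  by apply: strip_in_IRB => //; rewrite mxE.
- move=> K h xs.
  (* The quantile is fixed first, as [10^-5]; [alpha] is then [1 - q], with [q] the central mass. *)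
  pose z : R := 1 / 100 * (1 / 1000).
  have z0 : 0 < z by rewrite /z; lra.
  have z1 : z <= 1 / 100 by rewrite /z; lra.
  have p0 : 0 < normal_peak 1 :> R by rewrite normal_peak_gt0// oner_eq0.
  have p2 := normal_peak1_le R.
  set p := normal_peak 1 in p0 p2.
  have zNz : - z <= z by lra.
  pose q := fine (normal_prob 0 1 `[(- z), z]).
  have qE : normal_prob 0 1 `[(- z), z] = q%:E.
    by rewrite /q fineK//; exact: fin_num_measure.
  have q_le : q <= (z - - z) * p.
    rewrite -lee_fin -qE; apply: normal_prob_itv_le => // x _.
    by apply: normal_pdf_ub; rewrite oner_eq0.
  have q_ge : (z - - z) * (p * expR (- z ^+ 2 / 2)) <= q.
    rewrite -lee_fin -qE; apply: normal_prob_itv_ge => //.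
      by rewrite mulr_ge0 ?expR_ge0// ltW.
    move=> x xz; rewrite normal_pdf1E subr0 ler_pM2l// ler_expR.
    have : x ^+ 2 <= z ^+ 2.
      by rewrite -[X in X <= _]real_normK ?num_real// ler_pXn2r ?nnegrE ?ler_norml// ltW.
    by lra.
  have E_ge := expR_ge1Dx (- z ^+ 2 / 2).
  have zz : z ^+ 2 <= 1 / 1000 * (1 / 1000) by rewrite /z; lra.
  have K_le : expR (48 * z ^+ 2) <= 1001 / 1000.
    (* An upper bound on the exponential follows from a lower bound on its reciprocal. *)
    have e_ge := expR_ge1Dx (- (48 * z ^+ 2)).
    have : expR (48 * z ^+ 2) * expR (- (48 * z ^+ 2)) = 1.
      by rewrite -expRD subrr expR0.
    have := expR_gt0 (48 * z ^+ 2); nra.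
  have pz0 : 0 < p * z by rewrite mulr_gt0.
  have q0 : 0 < q.
    by apply: lt_le_trans q_ge; rewrite !mulr_gt0 ?expR_gt0//; lra.
  have q1 : q < 1 by apply: le_lt_trans q_le _; nra.
  exists (1 - q), z; split; first by apply/andP; split; lra.
  split; first by apply/upper_quantileE; rewrite ?(ltW z0)// qE subKr.
  rewrite subKr.
  have -> : dotv h xs = - 1.
    by rewrite /dotv !big_ord_recl big_ord0 !mxE /=; ring.
  rewrite /gauss3 mul1mx !mxE /=.
  have [_ _ mean] := mean_le_sec_bound R z z0.
  apply: le_lt_trans (le_trans (ge0_integral_mono _ _ _ _ _ _ _ _) mean) _.
  + by move=> y; exact: measure_ge0.
  + move=> [u v] /=; apply: le_trans (section_le z u v h _ _ _ z0 z1).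
    * by apply: normal_prob_mono => y; rewrite /xsection /= inE.
    * by rewrite mxE.
    * by rewrite mxE.
    * by rewrite mxE.
  + rewrite lte_fin; apply: lt_le_trans q_ge.
    rewrite -/p; set k := expR (48 * _) in K_le *; set E := expR _ in E_ge *.
    rewrite opprK (_ : (z + z) * (p * E) = 2 * p * z * E); last by ring.
    (* After division by [2 p z], the faces contribute less than 0.993 and the slabs
       [200 z p <= 1/1000], while [E] is within [10^-6] of 1. *)
    rewrite ltr_pM2l; last by rewrite -mulrA mulr_gt0.
    have : z * p <= 1 / 100 * (1 / 1000) * (1 / 2) by rewrite /z; lra.
    by lra.
Qed.
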